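(* Let $\mathbb{K}$ be a field, $S=\mathbb{K}[x_1,\dots,x_n]$, and let $I_2\subseteq I_1$ be two monomial ideals in $S$. Then there exists an integer $k\geq 1$ such that for every integer $s\geq 1$, $${\rm sdepth}\big(I_1^{sk}/I_2^{sk}\big) \leq {\rm sdepth}\big(\overline{I_1}/\overline{I_2}\big).$$
   Context: $S=\mathbb{K}[x_1,\dots,x_n]$ is the polynomial ring over a field $\mathbb{K}$ with its standard $\mathbb{Z}^n$-grading ($\deg x_i=e_i$). Stanley depth: let $M$ be a finitely generated $\mathbb{Z}^n$-graded $S$-module. For a homogeneous element $u\in M$ and a subset $Z\subseteq\{x_1,\dots,x_n\}$, let $u\mathbb{K}[Z]$ be the $\mathbb{K}$-subspace of $M$ generated by all elements $uv$ with $v\in\mathbb{K}[Z]$. It is called a Stanley space of dimension $|Z|$ if it is a free $\mathbb{K}[Z]$-module. A Stanley decomposition $\mathcal{D}$ of $M$ is a decomposition of $M$ (as a $\mathbb{K}$-vector space) as a finite direct sum of Stanley spaces. The Stanley depth ${\rm sdepth}(\mathcal{D})$ is the minimum dimension of a Stanley space in $\mathcal{D}$, and ${\rm sdepth}(M)$ is the maximum of ${\rm sdepth}(\mathcal{D})$ over all Stanley decompositions $\mathcal{D}$ of $M$. Convention: ${\rm sdepth}(0)=\infty$ (empty decomposition). Integral closure: for an ideal $I\subseteq S$, an element $f\in S$ is integral over $I$ if there is an equation $f^m+c_1f^{m-1}+\dots+c_{m-1}f+c_m=0$ with $m\ge 1$ and $c_i\in I^i$. The integral closure $\overline{I}$ is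 the set of all elements of $S$ integral over $I$. For a monomial ideal $I$, it is known that $\overline{I}$ is the monomial ideal generated by all monomials $u\in S$ such that $u^m\in I^m$ for some integer $m\geq 1$. *)

(* Defs.v *)
From HB Require Import structures.
From mathcomp Require Import all_boot all_order all_algebra.
From mathcomp Require Import generic_quotient ring_quotient.
From mathcomp Require Import boolp classical_sets.
From mathcomp Require Import mpoly.

Set Implicit Arguments.
Unset Strict Implicit.
Unset Printing Implicit Defensive.

Import GRing.Theory.
Local Open Scope ring_scope.
Local Open Scope classical_set_scope.

(* Ideals of a commutative ring R are the submodules of R over itself; the    *)
(* unit ideal is allowed, contrary to idealr of ring_quotient. Membership is  *)
(* boolean but, by asbool, every (Prop-valued) ideal is of this form.         *)
Notation ideal R := (submodClosed (R^o)).

Section Ideals.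
Variable R : comNzRingType.
Implicit Types (I : ideal R) (A : set R) (f x : R).

Lemma ideal0 I : (0 : R) \in I. Proof. exact: (@rpred0 R^o). Qed.

Lemma idealD I x y : x \in I -> y \in I -> x + y \in I.
Proof. exact: (@rpredD R^o). Qed.

Lemma idealM I a x : x \in I -> a * x \in I.
Proof. exact: (@rpredZ R R^o). Qed.

Lemma idealB I x y : x \in I -> y \in I -> x - y \in I.
Proof. by move=> xI yI; rewrite -mulN1r idealD ?idealM. Qed.

Lemma ideal_sum I (T : eqType) (s : seq T) (F : T -> R) :
  (forall i, i \in s -> F i \in I) -> \sum_(i <- s) F i \in I.
Proof. by move=> h; rewrite big_seq; exact: (@rpred_sum R^o). Qed.

Definition ideal_gen_pred A : pred R^o := fun x =>
  `[< exists s : seq (R * R), (forall p, p \in s -> A p.2) /\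
      x = \sum_(p <- s) p.1 * p.2 >].

Lemma ideal_genP A x :
  reflect (exists s : seq (R * R), (forall p, p \in s -> A p.2) /\
             x = \sum_(p <- s) p.1 * p.2) (x \in ideal_gen_pred A).
Proof. exact: asboolP. Qed.

Fact ideal_gen_closed A : GRing.submod_closed (ideal_gen_pred A).
Proof.
split.
  by apply/ideal_genP; exists [::]; split => //; rewrite big_nil.
move=> a x y /ideal_genP[s [hs ->]] /ideal_genP[t [ht ->]].
apply/ideal_genP; exists ([seq (a * p.1, p.2) | p <- s] ++ t); split.
  move=> p; rewrite mem_cat => /orP[/mapP[q qs ->]|]; last exact: ht.
  exact: hs qs.
rewrite big_cat big_map /=; congr (_ + _).
rewrite [LHS]mulr_sumr; apply: eq_bigr => p _; exact: mulrA.
Qed.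

Definition ideal_gen A : ideal R := HB.pack (ideal_gen_pred A)
  (GRing.isSubmodClosed.Build R R^o (ideal_gen_pred A) (ideal_gen_closed A)).

Lemma mem_ideal_gen A x : A x -> x \in ideal_gen A.
Proof.
move=> Ax; apply/ideal_genP; exists [:: (1, x)]; split.
  by move=> p; rewrite inE => /eqP->.
by rewrite big_seq1 mul1r.
Qed.

Lemma ideal_gen_sub A I : (forall x, A x -> x \in I) ->
  {subset ideal_gen A <= I}.
Proof.
move=> AI x /ideal_genP[s [hs ->]].
apply: ideal_sum => p ps; exact/idealM/AI/hs.
Qed.

Definition ideal_exp I (k : nat) : ideal R :=
  ideal_gen [set x | exists f : 'I_k -> R,
    (forall i, f i \in I) /\ x = \prod_(i < k) f i].

Lemma mem_ideal_expM I i j x y : x \in ideal_exp I i ->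
  y \in ideal_exp I j -> x * y \in ideal_exp I (i + j).
Proof.
move=> /ideal_genP[s [hs ->]] /ideal_genP[t [ht ->]].
rewrite mulr_suml; apply: ideal_sum => p /hs[f [fI ep]].
rewrite mulr_sumr; apply: ideal_sum => q /ht[g [gI eq]].
rewrite mulrACA.
apply: idealM; apply: mem_ideal_gen.
exists (fun l => match split l with inl a => f a | inr b => g b end); split.
  by move=> l; case: split.
rewrite ep eq big_split_ord /=; congr (_ * _); apply: eq_bigr => l _.
  by rewrite (unsplitK (inl l)).
by rewrite (unsplitK (inr l)).
Qed.

Lemma mem_ideal_exp0 I x : x \in ideal_exp I 0.
Proof.
rewrite -[x]mulr1; apply: idealM.
by apply: mem_ideal_gen; exists (fun=> 0); split=> [[]//|]; rewrite big_ord0.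
Qed.

Definition integral_over_ideal I f : Prop :=
  exists (m : nat) (c : nat -> R),
    [/\ (1 <= m)%N,
        forall i, (1 <= i <= m)%N -> c i \in ideal_exp I i &
        f ^+ m + \sum_(1 <= i < m.+1) c i * f ^+ (m - i) = 0].

Definition integral_closure_pred I : pred R^o :=
  fun f => `[< integral_over_ideal I f >].

(* The integral closure is an ideal: f is integral over I iff f 'X is         *)
(* integral over the Rees ring of polynomials whose i-th coefficient is in    *)
(* I ^ i, for all i.                                                          *)
Definition rees I : pred {poly R} :=
  fun p : {poly R} => `[< forall i, p`_i \in ideal_exp I i >].

Lemma reesP I (p : {poly R}) : reflect (forall i, p`_i \in ideal_exp I i) (p \in rees I).
Proof. exact: asboolP. Qed.

Lemma rees_closed I : GRing.subring_closed (rees I).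
Proof.
split.
- apply/reesP => -[|i]; first exact: mem_ideal_exp0.
  by rewrite coef1; exact: ideal0.
- move=> p q /reesP hp /reesP hq; apply/reesP => i.
  by rewrite coefB; exact: idealB.
- move=> p q /reesP hp /reesP hq; apply/reesP => i.
  rewrite coefM; apply: ideal_sum => j _.
  have := mem_ideal_expM (hp j) (hq (i - j)%N).
  by rewrite subnKC // -ltnS.
Qed.

HB.instance Definition _ I :=
  GRing.isSubringClosed.Build {poly R} (rees I) (rees_closed I).

Record rees_ring I := ReesRing {
  rees_val :> {poly R};
  rees_valP : rees_val \in rees I }.

HB.instance Definition _ I := [isSub for @rees_val I].
HB.instance Definition _ I := [Choice of rees_ring I by <:].
HB.instance Definition _ I := [SubChoice_isSubComNzRing of rees_ring I by <:].

Lemma integral_reesP I f : integral_over_ideal I f <->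
  integralOver (val : rees_ring I -> {poly R}) (f *: 'X).
Proof.
split=> [[m [c [m0 hc e]]]|[p pmon /rootP pf]].
  have cP j : (1 <= j <= m)%N -> c j *: 'X^j \in rees I.
    move=> jm; apply/reesP => i; rewrite coefZ coefXn.
    case: eqP => [->|_]; last by rewrite mulr0; exact: ideal0.
    by rewrite mulr1 hc.
  pose g (i : nat) : rees_ring I := insubd 0 (c (m - i)%N *: 'X^(m - i)).
  have gE i : (i < m)%N -> val (g i) = c (m - i)%N *: 'X^(m - i).
    by move=> im; rewrite insubdK // cP // subn_gt0 im leq_subr.
  exists ('X^m + \poly_(i < m) g i).
    rewrite monicE lead_coefDl ?lead_coefXn //.
    by rewrite size_polyXn ltnS size_poly.
  have eg : map_poly (val : rees_ring I -> {poly R}) (\poly_(i < m) g i) =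
            \poly_(i < m) val (g i).
    apply/polyP => i; rewrite coef_map_id0 ?rmorph0 // !coef_poly.
    by case: ifP => // _; rewrite rmorph0.
  have ex : map_poly (val : rees_ring I -> {poly R}) 'X^m = 'X^m.
    exact: map_polyXn.
  apply/rootP; transitivity (('X^m + \poly_(i < m) val (g i)).[f *: 'X]).
    by rewrite -ex -eg -(raddfD (map_poly (val : rees_ring I -> {poly R}))).
  rewrite hornerD hornerXn horner_poly.
  rewrite exprZn -[RHS](scale0r 'X^m) -e scalerDl; congr (_ + _).
  rewrite scaler_suml big_add1 big_mkord [RHS](reindex_inj rev_ord_inj) /=.
  apply: eq_bigr => i _; rewrite gE // subnSK // subKn ?(ltnW (ltn_ord i)) //.
  rewrite exprZn -scalerAl -scalerAr scalerA -exprD subnK //.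
  exact: ltnW.
pose m := (size p).-1.
have sp : size p = m.+1 by rewrite prednK // lt0n size_poly_eq0 monic_neq0.
have pm : p`_m = 1 by rewrite -(monicP pmon) lead_coefE.
pose c i := (val p`_(m - i))`_i.
have e : \sum_(i < m.+1) c (m - i)%N * f ^+ i = 0.
  have := congr1 (fun q : {poly R} => q`_m) pf.
  rewrite coef0 (@horner_coef_wide _ m.+1); last by rewrite -sp size_poly.
  rewrite coef_sum => h; rewrite -[RHS]h; apply: eq_bigr => i _.
  rewrite coef_map_id0 ?rmorph0 // exprZn -scalerAr coefZ coefMXn ltnNge.
  by rewrite -ltnS ltn_ord /= mulrC /c subKn // -ltnS.
have cm0 : c 0%N = 1 by rewrite /c subn0 pm rmorph1 coef1.
exists m, c; split.
- case: (posnP m) => // m0; move: e; rewrite m0 big_ord1 subnn cm0 mul1r expr0.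
  by move/eqP; rewrite oner_eq0.
- move=> i _; exact/reesP/valP.
- rewrite -[RHS]e big_ord_recr /= subnn cm0 mul1r [RHS]addrC; congr (_ + _).
  rewrite big_add1 big_mkord (reindex_inj rev_ord_inj) /=.
  apply: eq_bigr => i _; rewrite subnSK // subKn //; exact: ltnW.
Qed.

Lemma integral_closureP I f :
  reflect (integral_over_ideal I f) (f \in integral_closure_pred I).
Proof. exact: asboolP. Qed.

Fact integral_closure_closed I : GRing.submod_closed (integral_closure_pred I).
Proof.
split.
  apply/integral_closureP/integral_reesP; rewrite scale0r.
  exact: integral0.
move=> a f g /integral_closureP/integral_reesP hf.
move=> /integral_closureP/integral_reesP hg.
apply/integral_closureP/integral_reesP; rewrite scalerDl; apply: integral_add => //.
rewrite -[_ *: f]/(a * f) -scalerA -mul_polyC; apply: integral_mul => //.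
have aP : a%:P \in rees I.
  apply/reesP => -[|i]; first exact: mem_ideal_exp0.
  by rewrite coefC; exact: ideal0.
rewrite -[a%:P]/(val (ReesRing aP)); exact: integral_id.
Qed.

Definition integral_closure I : ideal R := HB.pack (integral_closure_pred I)
  (GRing.isSubmodClosed.Build R R^o (integral_closure_pred I)
    (integral_closure_closed I)).

End Ideals.

(* The quotient module I / J, for ideals J included in I (I / (I :&: J) in    *)
(* general).                                                                  *)
Section IdealQuotient.
Variables (R : comNzRingType) (I J : ideal R).

Record ideal_elt := IdealElt {
  ideal_val :> R^o;
  ideal_valP : ideal_val \in I }.

HB.instance Definition _ := [isSub for ideal_val].
HB.instance Definition _ := [Choice of ideal_elt by <:].
HB.instance Definition _ := [SubChoice_isSubLmodule of ideal_elt by <:].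

Definition in_ideal_pred : pred ideal_elt := fun x => val x \in J.

Fact in_ideal_closed : GRing.zmod_closed in_ideal_pred.
Proof.
split; first exact: ideal0.
by move=> x y xJ yJ; exact: idealB.
Qed.

Definition in_ideal : zmodClosed ideal_elt := HB.pack in_ideal_pred
  (GRing.isZmodClosed.Build ideal_elt in_ideal_pred in_ideal_closed).

Definition ideal_quo : Type := Quotient.quot in_ideal.

HB.instance Definition _ := Choice.on ideal_quo.
HB.instance Definition _ := GRing.Zmodule.on ideal_quo.
HB.instance Definition _ :
    EqQuotient ideal_elt (Quotient.equiv in_ideal) ideal_quo :=
  EqQuotient.on ideal_quo.

Definition ideal_pi : ideal_elt -> ideal_quo := \pi_(Quotient.quot in_ideal)%qT.

Lemma ideal_pi_eq x y : ideal_pi x = ideal_pi y <-> val x - val y \in J.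
Proof.
rewrite -[_ \in J]/(x - y \in in_ideal) Quotient.idealrBE.
by split=> [/eqP|/eqP].
Qed.

Lemma ideal_reprK u : ideal_pi (repr u)%qT = u.
Proof. exact: (@reprK _ (Quotient.quot in_ideal)). Qed.

Definition ideal_quo_scale (a : R) (u : ideal_quo) : ideal_quo :=
  ideal_pi (a *: repr u)%qT.

Lemma ideal_piZ a x : ideal_quo_scale a (ideal_pi x) = ideal_pi (a *: x).
Proof.
apply/ideal_pi_eq; rewrite -[_ - _]/(a * val _ - a * val x) -mulrBr.
by apply: idealM; apply/ideal_pi_eq; rewrite /ideal_pi reprK.
Qed.

Fact ideal_quo_scaleA a b u :
  ideal_quo_scale a (ideal_quo_scale b u) = ideal_quo_scale (a * b) u.
Proof.
rewrite -[u]ideal_reprK !ideal_piZ.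
by rewrite scalerA.
Qed.

Fact ideal_quo_scale1 : left_id 1 ideal_quo_scale.
Proof.
move=> u; rewrite -[u]ideal_reprK ideal_piZ.
by rewrite scale1r.
Qed.

Lemma ideal_piD x y : ideal_pi (x + y) = ideal_pi x + ideal_pi y.
Proof. exact: (raddfD \pi_(Quotient.quot in_ideal)%qT). Qed.

Fact ideal_quo_scaleDr : right_distributive ideal_quo_scale +%R.
Proof.
move=> a u v; rewrite -[u]ideal_reprK -[v]ideal_reprK.
by rewrite -ideal_piD !ideal_piZ -ideal_piD scalerDr.
Qed.

Fact ideal_quo_scaleDl u :
  {morph ideal_quo_scale^~ u : a b / a + b}.
Proof.
move=> a b; rewrite -[u]ideal_reprK.
by rewrite !ideal_piZ -ideal_piD scalerDl.
Qed.

HB.instance Definition _ := GRing.Zmodule_isLmodule.Build R ideal_quo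
  ideal_quo_scaleA ideal_quo_scale1 ideal_quo_scaleDr ideal_quo_scaleDl.

End IdealQuotient.

(* Natural numbers extended with infinity, encoded as None.                   *)
Section ExtendedNat.
Definition enat := option nat.

Definition le_enat (a b : enat) : bool :=
  match a, b with
  | _, None => true
  | None, Some _ => false
  | Some i, Some j => (i <= j)%N
  end.

Definition min_enat (a b : enat) : enat := if le_enat a b then a else b.

Definition is_max_enat (A : set enat) (d : enat) : Prop :=
  A d /\ forall e, A e -> le_enat e d.

Lemma bounded_max_enat (A : set enat) (n : nat) :
  A !=set0 -> (forall i, A (Some i) -> (i <= n)%N) ->
  exists d, is_max_enat A d.
Proof.
move=> [a Aa] bA; have [AN|nAN] := pselect (A None).
  by exists None; split=> // -[].
have exA : exists i, `[< A (Some i) >].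
  by case: a Aa => // i Ai; exists i; apply/asboolP.
have ubA i : `[< A (Some i) >] -> (i <= n)%N by move/asboolP; exact: bA.
case: (ex_maxnP exA ubA) => i /asboolP Ai imax.
by exists (Some i); split=> // -[j Aj|//]; apply: imax; apply/asboolP.
Qed.
End ExtendedNat.

Section StanleyDepth.
Variables (K : fieldType) (n : nat).
Local Notation S := {mpoly K[n]}.

(* The subalgebra K[Z] of S, for Z a set of (indices of) variables.           *)
Definition subpoly (Z : {set 'I_n}) : set S :=
  [set v | forall m i, m \in msupp v -> i \notin Z -> m i = 0%N].

Section GradedModule.
(* The Z^n-grading of M is given by its components comp a, for a in Z^n; only  *)
(* the resulting notion of homogeneous element matters below.                 *)
Variables (M : lmodType S) (comp : ('I_n -> int) -> set M).

Definition homogeneous (u : M) : Prop := exists a, comp a u.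

Definition stanley_space (u : M) (Z : {set 'I_n}) : set M :=
  [set w | exists2 v, subpoly Z v & w = v *: u].

(* u K[Z] is free over K[Z] with basis u; in particular u != 0. (Zero summands *)
(* in a decomposition could only lower its Stanley depth.)                    *)
Definition stanley_free (u : M) (Z : {set 'I_n}) : Prop :=
  forall v, subpoly Z v -> v *: u = 0 -> v = 0.

(* M is the direct sum of the u K[Z], for (u, Z) in D: every element of M is  *)
(* uniquely a sum of elements ws i of these spaces.                           *)
Definition stanley_decomposition (D : seq (M * {set 'I_n})) : Prop :=
  let u i := (tnth (in_tuple D) i).1 in
  let Z i := (tnth (in_tuple D) i).2 in
  (forall i, homogeneous (u i) /\ stanley_free (u i) (Z i)) /\
  (forall w : M, exists! ws : {ffun 'I_(size D) -> M},
    (forall i, stanley_space (u i) (Z i) (ws i)) /\ w = \sum_i ws i).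

Definition decomposition_sdepth (D : seq (M * {set 'I_n})) : enat :=
  \big[min_enat/None]_(p <- D) Some #|p.2|.

Definition sdepth_set : set enat :=
  [set decomposition_sdepth D | D in stanley_decomposition].

(* The maximum of sdepth_set. By sdepthP the default value is only reached    *)
(* if M has no Stanley decomposition, which does not happen for finitely      *)
(* generated M.                                                               *)
Definition sdepth : enat := xget (Some 0%N) (is_max_enat sdepth_set).

Lemma sdepthP : (exists D, stanley_decomposition D) ->
  is_max_enat sdepth_set sdepth.
Proof.
move=> [D hD]; rewrite /sdepth.
have [||d dP] := @bounded_max_enat sdepth_set n.
- by exists (decomposition_sdepth D); exists D.
- move=> i [E _]; rewrite /decomposition_sdepth.
  elim: E i => [|p E IH] i; first by rewrite big_nil.
  rewrite big_cons {1}/min_enat; case: ifP => _; last exact: IH.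
  by case=> <-; rewrite -[n in (_ <= n)%N]card_ord max_card.
- by case: xgetP => [//|/(_ d)].
Qed.

End GradedModule.

Definition monomial_ideal (I : ideal S) : Prop :=
  exists A : set 'X_{1..n}, I =i ideal_gen [set 'X_[m] | m in A].

(* The component of degree a of I / J, for J included in I monomial ideals:   *)
(* the image of the intersection of I with the component K x^a of S.          *)
Definition ideal_quo_comp (I J : ideal S) (a : 'I_n -> int) :
    set (ideal_quo I J) :=
  [set u | exists2 x : ideal_elt I, u = ideal_pi J x &
    exists (c : K) (m : 'X_{1..n}),
      (val x : S) = c *: 'X_[m] /\ forall i, Posz (m i) = a i].

Definition sdepth_quo (I J : ideal S) : enat := sdepth (@ideal_quo_comp I J).

End StanleyDepth.

(* Main.v *)
(* Let Q(I) be the set of exponents m such that X^(km) is in I^k for some     *)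
(* k >= 1. Then bar I is spanned by the monomials with exponent in Q(I), and  *)
(* by Dickson's lemma a single k works for all of Q(I), whence, for every     *)
(* multiple l of k, X^m is in bar I iff X^(lm) is in I^l. Stanley             *)
(* decompositions of I1^l / I2^l amount to partitions of a set of exponents   *)
(* into cones a + N^Z, and the preimage of such a partition under m |-> l m   *)
(* is a partition into cones with some of the same sets Z; it gives a Stanley *)
(* decomposition of bar I1 / bar I2.                                          *)
(* That exponents of elements f of bar I are in Q(I) is proved without convex *)
(* geometry: the exponents of f are adjoined to the Rees filtration (I^t)_t   *)
(* and then removed one by one, comparing coefficients in an integral         *)
(* equation of f.                                                             *)
Require Import Defs.
From mathcomp Require Import all_boot all_order all_algebra.
From mathcomp Require Import boolp classical_sets.
From mathcomp Require Import zify ring.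
From mathcomp Require Import mpoly.

Set Implicit Arguments.
Unset Strict Implicit.
Unset Printing Implicit Defensive.

Import GRing.Theory.
Local Open Scope ring_scope.
Local Open Scope classical_set_scope.

(** In terms of exponents the inequality is a transport of partitions. Homogeneous components of a
    quotient of monomial ideals have dimension at most one, so a Stanley decomposition is the same
    data as a partition into cones of the exponents of [I] outside [J], with the same sets [Z]
    ([cone_partition_of_decomposition], [decomposition_of_cone_partition]). For [l] a multiple of a
    suitable [k], multiplication by [l] pulls the exponents of the [l]-th power back to those of the
    integral closure, for [I1] and [I2] at once ([integral_closure_exponent]). A cone pulls back to
    nothing or to a cone with the same [Z] ([in_cone_mulm]), so an optimal decomposition for the
    powers yields one for the closures whose minimal dimension has not dropped ([sdepth_quo_root]).

    The algebraic core is [supported_saturate_integral]: each exponent of an element integral over a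
    filtration has a multiple that lies in the filtration in the corresponding degree. *)

(** * Dickson's lemma *)

Lemma dickson_seq (T I : eqType) (f : I -> T -> nat) (c : seq I) (A : set T) :
  exists s : seq T, (forall p, p \in s -> A p) /\
    forall x, A x -> exists2 p, p \in s & forall i, i \in c -> (f i p <= f i x)%N.
Proof.
elim: c A => [|i c IH] A.
  have [[a Aa]|nA] := pselect (exists a, A a).
    by exists [:: a]; split=> [p|x _]; [rewrite inE => /eqP->|exists a; rewrite ?inE].
  by exists [::]; split=> // x Ax; case: nA; exists x.
have [s [sA hs]] := IH A.
have /choice[g hg] v := IH [set x | A x /\ f i x = v].
(* [N] bounds coordinate [i] on [s]. An element at or beyond [N] there dominates a member of [s];
   the others fall into [N] slices, treated by [g]. *)
pose N := (\sum_(p <- s) f i p)%N.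
exists (s ++ flatten [seq g v | v <- iota 0 N]); split=> [p|x Ax].
  rewrite mem_cat => /orP[/sA//|/flattenP[t /mapP[v _ ->]]].
  by have [h _] := hg v; case/h.
have [Nx|xN] := leqP N (f i x).
  have [p ps hp] := hs x Ax; exists p; first by rewrite mem_cat ps.
  move=> j; rewrite inE => /predU1P[->|/hp//].
  by apply: leq_trans Nx; rewrite /N (big_rem p ps) /= leq_addr.
have [h1 h2] := hg (f i x).
have [//|p pg hp] := h2 x; exists p.
  rewrite mem_cat; apply/orP; right; apply/flattenP; exists (g (f i x)) => //.
  by apply/mapP; exists (f i x); rewrite // mem_iota.
move=> j; rewrite inE => /predU1P[->|/hp//].
by have [_ ->] := h1 _ pg.
Qed.

Lemma dickson (n : nat) (A : set 'X_{1..n}) :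
  exists s : seq 'X_{1..n}, (forall p, p \in s -> A p) /\
    forall x, A x -> exists2 p, p \in s & (p <= x)%MM.
Proof.
have [s [sA hs]] := @dickson_seq 'X_{1..n} 'I_n (fun i m => m i) (enum 'I_n) A.
exists s; split=> // x /hs[p ps hp]; exists p => //.
by apply/mnm_lepP => i; apply: hp; rewrite mem_enum.
Qed.

(** * Filtrations of exponents, their saturation, and integral elements *)

Section Filtrations.
Variable n : nat.
Implicit Types (G H : nat -> set 'X_{1..n}) (a x y : 'X_{1..n}).

Lemma mulmDr x y k : ((x + y) *+ k = x *+ k + y *+ k)%MM.
Proof. by apply/mnmP => i; rewrite mnmDE !mulmnE mnmDE mulnDl. Qed.

Lemma mulmM a p q : (a *+ (p * q) = (a *+ p) *+ q)%MM.
Proof. by apply/mnmP => i; rewrite !mulmnE mulnA. Qed.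

Lemma mulm_inj k : (0 < k)%N -> injective (fun x : 'X_{1..n} => (x *+ k)%MM).
Proof.
move=> k0 x y /mnmP e; apply/mnmP => i; apply/eqP.
by rewrite -(eqn_pmul2r k0) -!mulmnE; apply/eqP/e.
Qed.

Definition filtration G : Prop :=
  (forall x, G 0 x) /\
  forall i j x y, G i x -> G j y -> G (i + j)%N (x + y)%MM.

(** Exponent form of adjoining [X^a], placed in degree 1, to a Rees algebra. *)
Definition adjoin a G : nat -> set 'X_{1..n} := fun t =>
  [set x | exists p c, [/\ (p <= t)%N, G (t - p)%N c & x = (a *+ p + c)%MM]].

(** For the powers of a monomial ideal, the value at [t = 1] turns out to be the set of exponents of
    the integral closure. *)
Definition saturate G : nat -> set 'X_{1..n} := fun t =>
  [set x | exists2 k, (0 < k)%N & G (k * t)%N (x *+ k)%MM].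

Lemma filtration_mulm G t x k : filtration G -> G t x -> G (k * t)%N (x *+ k)%MM.
Proof.
move=> [G0 GM] Gx; elim: k => [|k IH]; first exact: G0.
by rewrite mulmS mulSn; apply: GM.
Qed.

Lemma adjoin_filtration a G : filtration G -> filtration (adjoin a G).
Proof.
move=> [G0 GM]; split=> [x|i j x y [p [c [pi Gc ->]]] [q [d [qj Gd ->]]]].
  by exists 0%N, x; split=> //; rewrite mulm0n add0m.
exists (p + q)%N, (c + d)%MM; split; first lia.
  have -> : (i + j - (p + q) = i - p + (j - q))%N by lia.
  exact: GM.
by apply/mnmP => l; rewrite !(mnmDE, mulmnE); lia.
Qed.

Lemma saturate_filtration G : filtration G -> filtration (saturate G).
Proof.
move=> GF; have [G0 GM] := GF; split=> [x|i j x y [k k0 Gk] [l l0 Gl]].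
  by exists 1%N.
exists (k * l)%N; first by rewrite muln_gt0 k0.
have -> : (k * l * (i + j) = l * (k * i) + k * (l * j))%N by ring.
have -> : ((x + y) *+ (k * l) = x *+ k *+ l + y *+ l *+ k)%MM.
  by apply/mnmP => h; rewrite !(mnmDE, mulmnE); ring.
by apply: GM; apply: filtration_mulm.
Qed.

(** After scaling by [l], each of the [p] copies of [a] becomes [a *+ l], an element of [G l], so
    [a] disappears from the expression. *)
Lemma saturate_adjoin a G t :
  filtration G -> saturate G 1 a -> saturate (adjoin a G) t `<=` saturate G t.
Proof.
move=> GF [l l0 Ga] x [k k0 [p [c [pk Gc e]]]].
exists (l * k)%N; first by rewrite muln_gt0 l0.
have -> : (l * k * t = p * (l * 1) + l * (k * t - p))%N by rewrite mulnBr; nia.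
have -> : (x *+ (l * k) = a *+ l *+ p + c *+ l)%MM.
  rewrite mulnC mulmM e; apply/mnmP => i; rewrite !(mnmDE, mulmnE); ring.
by apply: GF.2; apply: filtration_mulm.
Qed.

(* If [a] is not in the saturation, then the multiples of [a] have only the   *)
(* obvious expressions over [adjoin a G].                                     *)
Lemma saturate_adjoin_rigid a G i j x y : filtration G -> ~ saturate G 1 a ->
  saturate (adjoin a G) i x -> saturate (adjoin a G) j y ->
  (x + y = a *+ (i + j))%MM -> x = (a *+ i)%MM.
Proof.
move=> [G0 GM] na [k k0 [p [c [pk Gc ex]]]] [l l0 [q [d [ql Gd ey]]]] exy.
have GF : filtration G by [].
(* Both expressions are scaled to the common factor [k * l]; [N] is the total degree and [r] the
   number of copies of [a] used. If [r < N], cancelling them puts a positive multiple of [a] in [G]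
   and contradicts [na]. So [r = N], which forces [p = k * i] and [c = 0]. *)
pose N := (k * l * (i + j))%N; pose r := (p * l + q * k)%N.
have rN : (r <= N)%N by rewrite /r /N; nia.
have e : (a *+ N = a *+ r + (c *+ l + d *+ k))%MM.
  have -> : (a *+ N = (x + y) *+ (k * l))%MM by rewrite exy -mulmM /N mulnC.
  have -> : ((x + y) *+ (k * l) = x *+ k *+ l + y *+ l *+ k)%MM.
    by apply/mnmP => h; rewrite !(mnmDE, mulmnE); ring.
  by rewrite ex ey; apply/mnmP => h; rewrite !(mnmDE, mulmnE) /r; ring.
have e' : (a *+ (N - r) = c *+ l + d *+ k)%MM.
  apply/mnmP => h; move/mnmP/(_ h): e; rewrite !(mnmDE, mulmnE) mulnBr => ->; lia.
have [rltN|/(conj rN)/andP] := ltnP r N; last rewrite -eqn_leq => /eqP eN.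
  case: na; exists (N - r)%N; first by rewrite subn_gt0.
  rewrite e' muln1.
  have -> : (N - r = l * (k * i - p) + k * (l * j - q))%N.
    by rewrite /N /r !mulnBr; nia.
  by apply: GM; apply: filtration_mulm.
have pE : p = (k * i)%N by rewrite /r /N in eN; nia.
apply: (mulm_inj k0) => /=; rewrite ex pE.
apply/mnmP => h; move/mnmP/(_ h): e'.
by rewrite -eN subnn !(mnmDE, mulmnE); nia.
Qed.

Variable K : fieldType.
Implicit Types f : {mpoly K[n]}.

Definition supported f (A : set 'X_{1..n}) : Prop := forall x, x \in msupp f -> A x.

Lemma supportedX G f t k : filtration G -> supported f (G t) ->
  supported (f ^+ k) (G (k * t)%N).
Proof.
move=> [G0 GM] fG; elim: k => [x _|k IH]; first exact: G0.
rewrite exprS mulSn => x /msuppM_le/allpairsP[[y z] /= [/fG Gy /IH Gz ->]].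
exact: GM.
Qed.

Definition integral_over_filtration G f : Prop :=
  exists (m : nat) (c : nat -> {mpoly K[n]}),
    [/\ (1 <= m)%N,
        forall i, (1 <= i <= m)%N -> supported (c i) (G i) &
        f ^+ m + \sum_(1 <= i < m.+1) c i * f ^+ (m - i) = 0].

(* Were [a] not in the saturation of [G], the coefficient of [X^(ma)] in an   *)
(* integral equation of degree [m] of [f] would be [f_a ^ m].                 *)
Lemma saturate_adjoin_integral a G f : filtration G ->
  integral_over_filtration G f -> a \in msupp f ->
  supported f (saturate (adjoin a G) 1) -> supported f (saturate G 1).
Proof.
move=> GF [m [c [m0 hc e]]] af fS.
have [aS|na] := pselect (saturate G 1 a).
  by move=> x /fS; apply: saturate_adjoin.
have SF := saturate_filtration (adjoin_filtration a GF).
have fX k : supported (f ^+ k) (saturate (adjoin a G) k).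
  by rewrite -[k in saturate _ k]muln1; apply: supportedX.
have lead k : (f ^+ k)@_(a *+ k) = f@_a ^+ k.
  elim: k => [|k IH]; first by rewrite !expr0 mcoeff1 mulm0n eqxx.
  (* The term of [f] at [a] is split off one factor; by rigidity no other exponent of that factor
     contributes to [X^(a(k+1))]. *)
  rewrite exprS -[X in X * _](subrK (f@_a *: 'X_[a]) f) mulrDl mcoeffD.
  rewrite -scalerAl mcoeffZ ['X_[a] * _]mulrC mulmS mcoeffMX IH -exprS.
  rewrite -[RHS]add0r; congr (_ + _).
  apply/eqP; rewrite mcoeff_eq0; apply/negP => /msuppM_le/allpairsP[[x y] /= [xf yf exy]].
  have xa : x != a.
    apply: contraTneq xf => ->.
    by rewrite -mcoeff_eq0 mcoeffB mcoeffZ mcoeffX eqxx mulr1 subrr.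
  have {}xf : x \in msupp f.
    move: xf; rewrite !mcoeff_msupp mcoeffB mcoeffZ mcoeffX.
    by rewrite [a == x]eq_sym (negbTE xa) mulr0 subr0.
  have := @saturate_adjoin_rigid a G 1 k x y GF na (fS _ xf) (fX _ _ yf).
  by rewrite -exy add1n mulmS mulm1n => /(_ erefl)/eqP; rewrite (negbTE xa).
have /(congr1 (mcoeff (a *+ m)%MM)) := e.
rewrite mcoeffD lead mcoeff0 raddf_sum /= big1_seq ?addr0 => [|i].
  by move/eqP; rewrite expf_eq0 m0 mcoeff_eq0 af.
rewrite mem_index_iota => /andP[_ /andP[i1 im]].
apply/eqP; rewrite mcoeff_eq0; apply/negP => /msuppM_le/allpairsP[[x y] /= [xc yf exy]].
have Gx := hc i _ x xc; have {}Gx : G i x by apply: Gx; rewrite i1.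
have Sx : saturate (adjoin a G) i x.
  exists 1%N => //; rewrite mul1n; exists 0%N, x; split=> //; first by rewrite subn0.
  by rewrite mulm0n add0m.
(* Rigidity makes the exponent [x] of [c i] equal to [a *+ i]; since [x] is in [G i], this puts [a]
   in the saturation. *)
have xE : x = (a *+ i)%MM.
  apply: (saturate_adjoin_rigid GF na Sx (fX _ _ yf)).
  by rewrite -exy subnKC.
by apply: na; exists i => //; rewrite muln1 -xE.
Qed.

Lemma supported_saturate_integral G f : filtration G ->
  integral_over_filtration G f -> supported f (saturate G 1).
Proof.
move=> GF fG.
(* With all exponents of [f] adjoined, the support condition is immediate. They are then removed one
   by one; integrality over [G] persists over every larger filtration met on the way. *)
suff main s : {subset s <= msupp f} ->
    supported f (saturate (foldr adjoin G s) 1) -> supported f (saturate G 1).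
  apply: (main (msupp f)) => // x.
  elim: (msupp f) => // a s IH /=; rewrite inE => /predU1P[->|/IH[k k0 hk]].
    exists 1%N => //; exists 1%N, 0%MM; split=> //; last by rewrite addm0.
    elim: s {IH} => [|b s IH] /=; first exact: GF.1.
    by exists 0%N, 0%MM; split; rewrite // mulm0n add0m.
  exists k => //; exists 0%N, (x *+ k)%MM; split; rewrite ?subn0 //.
  by rewrite mulm0n add0m.
have sF (s' : seq 'X_{1..n}) : filtration (foldr adjoin G s').
  by elim: s' => //= a s' IH; apply: adjoin_filtration.
elim: s => //= a s IH asf fS; apply: IH.
  by move=> x xs; apply: asf; rewrite inE xs orbT.
apply: saturate_adjoin_integral fS; first exact: sF.
  have [m [c [m0 hc e]]] := fG; exists m, c; split=> // i im x /(hc i im).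
  elim: s {asf} x => //= b s IH x /IH Gx; exists 0%N, x; rewrite subn0.
  by split=> //; rewrite mulm0n add0m.
by apply: asf; rewrite inE eqxx.
Qed.

End Filtrations.

(** * Monomial ideals, their powers and integral closures *)

Section MonomialIdeals.
Variables (K : fieldType) (n : nat).
Implicit Types (I : ideal {mpoly K[n]}) (f : {mpoly K[n]}) (m : 'X_{1..n}).

Definition exponents I : set 'X_{1..n} := [set m | 'X_[m] \in I].

(** This form of monomiality passes to powers and integral closures without naming generators. *)
Definition closed_under_support I : Prop :=
  forall f, f \in I -> supported f (exponents I).

Lemma supported_mem I f : supported f (exponents I) -> f \in I.
Proof.
move=> fI; rewrite [f]mpolyE; apply: ideal_sum => m /fI mI.
by rewrite -mul_mpolyC; apply: idealM.
Qed.

Lemma supportedM I g f : supported f (exponents I) -> supported (g * f) (exponents I).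
Proof.
move=> fI x /msuppM_le/allpairsP[[y z] /= [_ /fI zI ->]].
by rewrite /exponents /= mpolyXD; apply: idealM.
Qed.

Lemma supported_sum (A : set 'X_{1..n}) (T : eqType) (s : seq T) (F : T -> {mpoly K[n]}) :
  (forall i, i \in s -> supported (F i) A) -> supported (\sum_(i <- s) F i) A.
Proof.
elim: s => [|a s IH] FA x; first by rewrite big_nil msupp0.
rewrite big_cons => /msuppD_le; rewrite mem_cat => /orP[|].
  by apply: FA; rewrite inE eqxx.
by apply: IH => i si; apply: FA; rewrite inE si orbT.
Qed.

Lemma monomial_ideal_support I : monomial_ideal I -> closed_under_support I.
Proof.
move=> [A IA] f; rewrite IA => /ideal_genP[s [sA ->]].
apply: supported_sum => p /sA[m Am <-]; apply: supportedM => x.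
move/mem_msuppXP=> <-; rewrite /exponents /= IA; apply: mem_ideal_gen.
by exists m.
Qed.

Lemma mem_ideal_exp1 I f : f \in I -> f \in ideal_exp I 1.
Proof.
move=> fI; apply: mem_ideal_gen; exists (fun=> f); split=> //.
by rewrite big_ord1.
Qed.

Definition rees_exponents I : nat -> set 'X_{1..n} :=
  fun t => exponents (ideal_exp I t).

Lemma rees_exponents_filtration I : filtration (rees_exponents I).
Proof.
split=> [x|i j x y xI yI]; first exact: mem_ideal_exp0.
by rewrite /rees_exponents /exponents /= mpolyXD; apply: mem_ideal_expM.
Qed.

Lemma ideal_exp_support I k :
  closed_under_support I -> closed_under_support (ideal_exp I k).
Proof.
move=> Isupp f /ideal_genP[s [sA ->]].
apply: supported_sum => p /sA[g [gI ->]]; apply: supportedM.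
elim: k {sA} g gI => [|k IH] g gI; first by move=> x _; apply: mem_ideal_exp0.
rewrite big_ord_recl => x /msuppM_le/allpairsP[[y z] /= [yg zg ->]].
rewrite /exponents /= mpolyXD; apply: (@mem_ideal_expM _ I 1 k).
  exact/mem_ideal_exp1/(Isupp (g ord0)).
by apply: (IH (fun i => g (lift ord0 i))) => // i; apply: gI.
Qed.

Lemma integral_closure_support_saturate I f : closed_under_support I ->
  f \in integral_closure I -> supported f (saturate (rees_exponents I) 1).
Proof.
move=> Isupp /integral_closureP[m [c [m0 hc e]]].
apply: supported_saturate_integral; first exact: rees_exponents_filtration.
exists m, c; split=> // i /hc ci; exact: ideal_exp_support.
Qed.

(** [X^m] is a root of [Y^k - X^(km)], whose only nonzero lower coefficient is the constant one. *)
Lemma mem_integral_closureX I m :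
  saturate (rees_exponents I) 1 m -> 'X_[m] \in integral_closure I.
Proof.
move=> [k k0]; rewrite muln1 => mk; apply/integral_closureP.
exists k, (fun i => if i == k then - 'X_[m *+ k] else 0); split=> // [i _|].
  case: eqP => [->|_]; last exact: ideal0.
  by rewrite -mulN1r; apply: idealM.
rewrite big_nat_recr //= eqxx subnn expr0 mulr1 mpolyXn.
rewrite big_nat big1 ?add0r ?subrr // => i /andP[_ ik].
by rewrite (ltn_eqF ik) mul0r.
Qed.

Lemma integral_closure_support I :
  closed_under_support I -> closed_under_support (integral_closure I).
Proof.
by move=> Isupp f /(integral_closure_support_saturate Isupp) fS x /fS /mem_integral_closureX.
Qed.

(** By Dickson's lemma finitely many exponents [p] lie below all those of the closure, and the
    product of their individual multipliers serves them all. For [m] above [p], the surplus [m - p]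
    only contributes a monomial factor. The converse direction holds for every positive [l]. *)
Lemma integral_closure_exponent I : closed_under_support I ->
  exists2 k, (0 < k)%N & forall l m, (0 < l)%N -> (k %| l)%N ->
    ('X_[m] \in integral_closure I) = ('X_[m *+ l] \in ideal_exp I l).
Proof.
move=> Isupp.
have [s [sA hs]] := dickson (exponents (integral_closure I)).
have [k k0 hk] : exists2 k, (0 < k)%N &
    forall p, p \in s -> rees_exponents I k (p *+ k)%MM.
  elim: s sA {hs} => [|p s IH] sA; first by exists 1%N.
  have [|k k0 hk] := IH; first by move=> q qs; apply: sA; rewrite inE qs orbT.
  have /integral_closure_support_saturate pS : 'X_[p] \in integral_closure I.
    by apply: sA; rewrite inE eqxx.
  have [|l l0] := pS Isupp p; first by rewrite msuppX inE.
  rewrite muln1 => pl; exists (k * l)%N; first by rewrite muln_gt0 k0.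
  have RF := rees_exponents_filtration I.
  move=> q; rewrite inE => /predU1P[->|/hk qk].
    by rewrite [in X in (_ *+ X)%MM]mulnC mulmM; apply: filtration_mulm.
  by rewrite mulmM mulnC; apply: filtration_mulm.
exists k => // l m l0 /dvdnP[q lE]; apply/idP/idP => [/hs[p /hk pk pm]|ml].
  rewrite -(submK pm) mulmDr mpolyXD; apply: idealM.
  rewrite lE mulnC mulmM mulnC.
  exact: (filtration_mulm _ (rees_exponents_filtration I)).
by apply: mem_integral_closureX; exists l; rewrite ?muln1.
Qed.

End MonomialIdeals.

(** * Cones of exponents and partitions into cones *)

Section Cones.
Variable n : nat.
Implicit Types (m : 'X_{1..n}) (p : 'X_{1..n} * {set 'I_n}) (P : set 'X_{1..n}).

Definition in_cone m p : bool :=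
  [forall i, (p.1 i <= m i)%N && ((i \in p.2) || (m i == p.1 i))].

Lemma in_coneP m p : reflect (exists2 z : 'X_{1..n},
  m = (z + p.1)%MM & forall i, i \notin p.2 -> z i = 0%N) (in_cone m p).
Proof.
apply: (iffP forallP) => [h|[z -> hz] i].
  exists (m - p.1)%MM; first by rewrite submK //; apply/mnm_lepP => i; case/andP: (h i).
  move=> i iZ; rewrite mnmBE; have := h i; rewrite (negbTE iZ) /= => /andP[_ /eqP->].
  exact: subnn.
rewrite mnmDE leq_addl /=; have [//|/hz->] := boolP (i \in p.2).
exact: eqxx.
Qed.

(** Counting with multiplicity states covering and disjointness at once and is compatible with [map]
    and [filter]. *)
Definition cone_partition P (L : seq ('X_{1..n} * {set 'I_n})) : Prop :=
  forall m, count (in_cone m) L = `[< P m >].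

Lemma count_card (T : Type) (x0 : T) (a : pred T) (s : seq T) N : size s = N ->
  count a s = #|[pred i : 'I_N | a (nth x0 s i)]|.
Proof.
move=> <-; rewrite -sum1_count -sum1_card (big_nth x0) big_mkord.
by apply: eq_bigl => i.
Qed.

Lemma cone_partitionP x0 P L N : size L = N ->
  cone_partition P L <->
  [/\ forall (i : 'I_N) m, in_cone m (nth x0 L i) -> P m,
      forall m, P m -> exists i : 'I_N, in_cone m (nth x0 L i) &
      forall (i j : 'I_N) m, in_cone m (nth x0 L i) -> in_cone m (nth x0 L j) ->
        i = j].
Proof.
move=> sL; split=> [LP|[sub cov dis] m].
  have cardE m : #|[pred i : 'I_N | in_cone m (nth x0 L i)]| = `[< P m >].
    by rewrite -(count_card x0 _ sL) LP.
  split=> [i m mi|m Pm|i j m mi mj].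
  - by have := cardE m; case: asboolP => // _ /card0_eq/(_ i); rewrite inE mi.
  - have /card_gt0P[i] : (0 < #|[pred i : 'I_N | in_cone m (nth x0 L i)]|)%N.
      by rewrite cardE asboolT.
    by exists i.
  - have /card_le1P/(_ i mi)/(_ j) : (#|[pred i : 'I_N | in_cone m (nth x0 L i)]| <= 1)%N.
      by rewrite cardE; case: asboolP.
    by rewrite !inE mj => /esym/eqP.
rewrite (count_card x0 _ sL); case: asboolP => [/cov[i mi]|nP].
  apply: (@eq_card1 _ i) => j; rewrite !inE; apply/idP/eqP => [mj|->//].
  exact: dis mj mi.
by apply: eq_card0 => i; apply/negP => /sub.
Qed.

(* The preimage of a cone under [m |-> m *+ l] is empty or the cone whose     *)
(* apex is divided by [l], rounding up.                                       *)
Definition cone_root l p : 'X_{1..n} * {set 'I_n} :=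
  ([multinom ((p.1 i + l.-1) %/ l)%N | i < n], p.2).

(** Coordinates outside [Z] are constant on the cone, so it contains multiples of [l] only if these
    are divisible by [l]. *)
Definition cone_rootable l p : bool := [forall i, (i \in p.2) || (l %| p.1 i)%N].

Lemma in_cone_mulm l m p : (0 < l)%N ->
  in_cone (m *+ l)%MM p = cone_rootable l p && in_cone m (cone_root l p).
Proof.
move=> l0.
have leE i : (p.1 i <= m i * l)%N = ((cone_root l p).1 i <= m i)%N.
  by rewrite mnmE -[RHS]ltnS ltn_divLR // mulSn; lia.
have eqE i : (m i * l == p.1 i) = (l %| p.1 i)%N && (m i == (cone_root l p).1 i).
  rewrite mnmE; apply/eqP/andP => [<-|[/dvdnP[q ->] /eqP->]].
    by rewrite dvdn_mull // divnMDl // divn_small ?addn0 // prednK.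
  by rewrite divnMDl // divn_small ?addn0 // prednK.
apply/forallP/andP => [h|[/forallP h1 /forallP h2] i].
  split; apply/forallP => i; have := h i; rewrite mulmnE leE eqE.
    by case: (i \in p.2) => //= /and3P[].
  by case: (i \in p.2) => //= /and3P[-> _ ->].
rewrite mulmnE leE eqE; have := h1 i; have /andP[-> /=] := h2 i.
by case: (i \in p.2) => //= -> ->.
Qed.

Lemma cone_partition_root l (P P' : set 'X_{1..n}) L : (0 < l)%N ->
  (forall m, P' m <-> P (m *+ l)%MM) -> cone_partition P L ->
  cone_partition P' [seq cone_root l p | p <- L & cone_rootable l p].
Proof.
move=> l0 PP' LP m; rewrite count_map count_filter.
transitivity (count (in_cone (m *+ l)%MM) L).
  by apply: eq_count => p; rewrite /= in_cone_mulm // andbC.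
by rewrite LP; congr (nat_of_bool _); apply/asboolP/asboolP => /PP'.
Qed.

End Cones.

(** * Stanley decompositions of a quotient as cone partitions *)

Section StanleyCones.
Variables (K : fieldType) (n : nat) (I J : ideal {mpoly K[n]}).
Hypotheses (Isupp : closed_under_support I) (Jsupp : closed_under_support J).
Local Notation M := (ideal_quo I J).
Implicit Types (m b : 'X_{1..n}) (Z : {set 'I_n}) (v : {mpoly K[n]}).

Definition quo_exponents : set 'X_{1..n} := exponents I `\` exponents J.

Lemma ideal_pi0P (x : ideal_elt I) : ideal_pi J x = 0 <-> val x \in J.
Proof.
have pi0 : ideal_pi J (0 : ideal_elt I) = 0 by exact: raddf0.
by rewrite -pi0 ideal_pi_eq subr0.
Qed.

Lemma ideal_pi_scale v (x : ideal_elt I) : v *: ideal_pi J x = ideal_pi J (v *: x).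
Proof. exact: ideal_piZ. Qed.

Lemma val_scale v (x : ideal_elt I) :
  (val (v *: x) : {mpoly K[n]}) = v * (val x : {mpoly K[n]}).
Proof. by []. Qed.

Lemma ideal_pi_sum (T : Type) (s : seq T) (F : T -> ideal_elt I) :
  \sum_(i <- s) ideal_pi J (F i) = ideal_pi J (\sum_(i <- s) F i).
Proof.
have pi0 : ideal_pi J (0 : ideal_elt I) = 0 by exact: raddf0.
by rewrite (big_morph (ideal_pi J) (@ideal_piD _ I J) pi0).
Qed.

Lemma val_sum (T : Type) (s : seq T) (F : T -> ideal_elt I) :
  (val (\sum_(i <- s) F i) : {mpoly K[n]}) = \sum_(i <- s) (val (F i) : {mpoly K[n]}).
Proof. exact: raddf_sum. Qed.

Lemma msupp_subpoly_mul Z v c b m : subpoly Z v ->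
  m \in msupp (v * (c *: 'X_[b])) -> in_cone m (b, Z).
Proof.
move=> vZ /msuppM_le/allpairsP[[x y] /= [xv /msuppZ_le/mem_msuppXP<- ->]].
by apply/in_coneP; exists x => // i; apply: vZ.
Qed.

Lemma homogeneous_monomial (u : M) Z :
  homogeneous (@ideal_quo_comp _ _ I J) u -> stanley_free u Z ->
  exists b (c : K) (x : ideal_elt I),
    [/\ c != 0, u = ideal_pi J x & (val x : {mpoly K[n]}) = c *: 'X_[b]].
Proof.
move=> [a [x -> [c [b [xE _]]]]] free; exists b, c, x; split=> //.
apply/negP => /eqP c0; suff /eqP : (1 : {mpoly K[n]}) = 0 by rewrite oner_eq0.
apply: free.
  by move=> m i; rewrite msupp1 inE => /eqP-> _; rewrite mnm0E.
by rewrite scale1r; apply/ideal_pi0P; rewrite xE c0 scale0r ideal0.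
Qed.

(** Any exponent of a monomial representative will do; the default [0] is never reached for the
    generators in a Stanley decomposition. *)
Definition degree_of (u : M) : 'X_{1..n} :=
  xget 0%MM [set b | exists (c : K) (x : ideal_elt I),
    [/\ c != 0, u = ideal_pi J x & (val x : {mpoly K[n]}) = c *: 'X_[b]]].

(** Freeness keeps the monomials of each cone out of [J], spanning makes the cones cover, and
    uniqueness of the summands makes them disjoint. *)
Lemma cone_partition_of_decomposition (D : seq (M * {set 'I_n})) :
  stanley_decomposition (@ideal_quo_comp _ _ I J) D ->
  cone_partition quo_exponents [seq (degree_of p.1, p.2) | p <- D].
Proof.
move=> [/= hom dec]; set u := fun i => (tnth (in_tuple D) i).1.
set Z := fun i => (tnth (in_tuple D) i).2.
pose b i := degree_of (u i).
have /choice[c /choice[x xP]] : forall i, exists c : K, exists x : ideal_elt I,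
    [/\ c != 0, u i = ideal_pi J x & (val x : {mpoly K[n]}) = c *: 'X_[b i]].
  move=> i; have [hu fu] := hom i; exact: (xgetPex 0%MM (homogeneous_monomial hu fu)).
have nthE i : nth (0%MM, finset.set0) [seq (degree_of p.1, p.2) | p <- D] (i : 'I_(size D))
    = (b i, Z i).
  by rewrite (nth_map (0, finset.set0)) // /b /u /Z (tnth_nth (0, finset.set0)).
have sub i m : in_cone m (b i, Z i) -> quo_exponents m.
  move=> /in_coneP[z -> /= hz]; have [c0 uE xE] := xP i.
  have bI : 'X_[b i] \in I.
    rewrite -['X_[_]](scalerK c0) -xE -mul_mpolyC; apply: idealM.
    exact: ideal_valP.
  rewrite /quo_exponents; split; first by rewrite /exponents /= mpolyXD; apply: idealM.
  rewrite /exponents /= mpolyXD => zJ.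
  have /(congr1 (mcoeff z))/eqP : 'X_[z] = 0 :> {mpoly K[n]}.
    apply: (hom i).2 => [y j /mem_msuppXP<-|]; first exact: hz.
    rewrite -/(u i) uE ideal_pi_scale; apply/ideal_pi0P.
    rewrite val_scale xE -scalerAr -mul_mpolyC.
    exact: idealM.
  by rewrite mcoeffX eqxx mcoeff0 oner_eq0.
apply/(cone_partitionP (0%MM, finset.set0)); first exact: size_map.
split=> [i m|m [mI mJ]|i j m].
- rewrite nthE; exact: sub.
- have [ws [[wsP wE] _]] := dec (ideal_pi J (IdealElt mI)).
  have /choice[v vP] : forall i, exists v, subpoly (Z i) v /\ ws i = v *: u i.
    by move=> i; have [v] := wsP i; exists v.
  apply: contrapT => nm; apply: mJ.
  (* If no cone contains [m], the sum has no term at [X^m], so the difference has coefficient 1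
     there; support closure of [J] then gives [X^m] in [J]. *)
  have : 'X_[m] - \sum_i v i * (c i *: 'X_[b i]) \in J.
    have : ideal_pi J (IdealElt mI) = ideal_pi J (\sum_i v i *: x i).
      rewrite wE -ideal_pi_sum; apply: eq_bigr => i _.
      by have [_ uE _] := xP i; rewrite (vP i).2 uE ideal_pi_scale.
    move/ideal_pi_eq; rewrite val_sum; congr (_ - _ \in J).
    apply: eq_bigr => i _; have [_ _ <-] := xP i.
    by [].
  move/Jsupp; apply; rewrite mcoeff_msupp mcoeffB mcoeffX eqxx raddf_sum /=.
  rewrite big1 ?subr0 ?oner_eq0 // => i _; apply/eqP; rewrite mcoeff_eq0.
  apply/negP => /(msupp_subpoly_mul (vP i).1) mi; apply: nm.
  by exists i; rewrite nthE.
- rewrite !nthE => mi mj; apply: contrapT => ij.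
  have [mI mJ] := sub i m mi.
  have [ws [_ uniq_ws]] := dec (ideal_pi J (IdealElt mI)).
  set w := ideal_pi J _ in uniq_ws.
  (* Each cone containing [m] gives an expression of [w] concentrated in that cone; two such cones
     would make [w] zero. *)
  have wP k : in_cone m (b k, Z k) -> ws = [ffun l => if l == k then w else 0].
    move=> /in_coneP[z /= mE hz]; apply: uniq_ws; split.
      move=> l; rewrite ffunE; case: eqP => [->|_]; last first.
        by exists 0; rewrite ?scale0r // => y h; rewrite msupp0.
      have [c0 uE xE] := xP k; exists ((c k)^-1 *: 'X_[z]).
        by move=> y h /msuppZ_le/mem_msuppXP<-; apply: hz.
      rewrite -/(u k) uE ideal_pi_scale; congr ideal_pi; apply: val_inj.
      rewrite val_scale xE -scalerAl -scalerAr scalerA.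
      by rewrite mulVf // scale1r -mpolyXD -mE.
    rewrite (bigD1 k) //= big1 ?addr0 ?ffunE ?eqxx // => l /negbTE lk.
    by rewrite ffunE lk.
  have := congr1 (fun g : {ffun _} => g i) (etrans (esym (wP i mi)) (wP j mj)).
  by rewrite !ffunE eqxx; case: eqP => // _ /ideal_pi0P.
Qed.

Lemma mcoeff_restrict (f : {mpoly K[n]}) (C : pred 'X_{1..n}) m :
  (\sum_(x <- msupp f | C x) f@_x *: 'X_[x])@_m = if C m then f@_m else 0.
Proof.
rewrite raddf_sum big_mkcond /=.
transitivity (\sum_(x <- msupp f) if C m then (f@_x *: 'X_[x])@_m else 0).
  apply: eq_bigr => x _; rewrite mcoeffZ mcoeffX.
  by have [->//|_] := eqVneq x m; rewrite mulr0; do 2 case: ifP.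
case: ifP => _; last by rewrite big1.
by rewrite [in RHS](mpolyE f) raddf_sum.
Qed.

(** Summands over different cones have disjoint supports, so nothing cancels and a relation modulo
    [J] would put an exponent of a cone into [J]. For spanning, each term of an element of [I]
    either lies in [J] or belongs to exactly one cone. *)
Lemma decomposition_of_cone_partition (L : seq ('X_{1..n} * {set 'I_n})) :
  cone_partition quo_exponents L ->
  exists2 D, stanley_decomposition (@ideal_quo_comp _ _ I J) D &
    [seq p.2 | p <- D] = [seq p.2 | p <- L].
Proof.
pose g m : ideal_elt I := insubd 0 'X_[m].
have gE m : quo_exponents m -> val (g m) = 'X_[m].
  by move=> [mI _]; rewrite insubdK.
pose D := [seq (ideal_pi J (g p.1), p.2) | p <- L].
have sD : size L = size D by rewrite size_map.
move=> /(cone_partitionP (0%MM, finset.set0) _ sD).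
set q := fun i : 'I_(size D) => nth (0%MM, finset.set0) L i.
rewrite -/(q _) => -[sub cov dis].
have DE i : tnth (in_tuple D) i = (ideal_pi J (g (q i).1), (q i).2).
  by rewrite (tnth_nth (0, finset.set0)) /= (nth_map (0%MM, finset.set0)) // sD.
have qP i : quo_exponents (q i).1.
  by apply: (sub i); apply/in_coneP; exists 0%MM; rewrite ?add0m // => j; rewrite mnm0E.
have sumJ (v : 'I_(size D) -> {mpoly K[n]}) :
    (forall i, subpoly (q i).2 (v i)) -> \sum_i v i * 'X_[(q i).1] \in J ->
    forall i, v i = 0.
  move=> vZ /Jsupp sJ i; apply: msuppnil0; case E : (msupp (v i)) => [//|x s].
  have xv : x \in msupp (v i) by rewrite E inE eqxx.
  have mi : in_cone (x + (q i).1)%MM (q i).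
    by apply/in_coneP; exists x => // j; apply: vZ.
  have [_ []] := sub i _ mi; apply: sJ.
  rewrite mcoeff_msupp raddf_sum (bigD1 i) //= big1 ?addr0.
    by rewrite addmC mcoeffMX -mcoeff_msupp.
  move=> j ji; apply/eqP; rewrite mcoeff_eq0 -['X_[(q j).1]]scale1r; apply/negP.
  move=> /(msupp_subpoly_mul (vZ j)); rewrite -surjective_pairing => mj.
  by move/eqP: ji; apply; apply: dis mj mi.
exists D; last by rewrite -map_comp.
split=> [i|w] /=.
  rewrite DE /=; split.
    exists (fun j => Posz ((q i).1 j)); exists (g (q i).1) => //.
    by exists 1, (q i).1; rewrite scale1r; split=> //; apply: gE.
  move=> v vZ; rewrite ideal_pi_scale => /ideal_pi0P.
  rewrite val_scale gE // => /Jsupp sJ.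
  apply: msuppnil0; case E : (msupp v) => [//|x s].
  have [|_ []] := sub i (x + (q i).1)%MM.
    by apply/in_coneP; exists x => // j; apply: vZ; rewrite E inE eqxx.
  by apply: sJ; rewrite mcoeff_msupp addmC mcoeffMX -mcoeff_msupp E inE eqxx.
have piE (v : 'I_(size D) -> {mpoly K[n]}) :
    \sum_i v i *: (tnth (in_tuple D) i).1 = ideal_pi J (\sum_i v i *: g (q i).1).
  by rewrite -ideal_pi_sum; apply: eq_bigr => i _; rewrite DE ideal_pi_scale.
have valE (v : 'I_(size D) -> {mpoly K[n]}) :
    val (\sum_i v i *: g (q i).1) = \sum_i v i * 'X_[(q i).1].
  by rewrite val_sum; apply: eq_bigr => i _; rewrite -(gE _ (qP i)).
rewrite -[w]ideal_reprK; set f := repr w.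
(* [v i] collects the terms of [f] in cone [i], divided by the monomial of its apex. *)
pose v (i : 'I_(size D)) : {mpoly K[n]} :=
  \sum_(m <- msupp (val f) | in_cone m (q i)) (val f)@_m *: 'X_[m - (q i).1].
have vZ i : subpoly (q i).2 (v i).
  move=> x j xv xj; apply/eqP; apply: contraTT xv => xj0.
  rewrite mcoeff_msupp negbK raddf_sum big1 //= => m /in_coneP[z -> hz].
  rewrite addmK mcoeffZ mcoeffX; case: eqP => [zx|_]; last by rewrite mulr0.
  by rewrite -zx hz in xj0.
have vE i : v i * 'X_[(q i).1] =
    \sum_(m <- msupp (val f) | in_cone m (q i)) (val f)@_m *: 'X_[m].
  rewrite mulr_suml; apply: eq_bigr => m /in_coneP[z -> _].
  by rewrite addmK -scalerAl -mpolyXD.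
have fE : ideal_pi J f = ideal_pi J (\sum_i v i *: g (q i).1).
  apply/ideal_pi_eq; rewrite valE; apply: supported_mem => m.
  under eq_bigr do rewrite vE.
  rewrite mcoeff_msupp mcoeffB raddf_sum /=.
  under eq_bigr do rewrite mcoeff_restrict.
  have [f0|mf] := eqVneq (val f)@_m 0.
    by rewrite f0 sub0r oppr_eq0 big1 ?eqxx // => i _; rewrite if_same.
  have [//|mJ] := pselect (exponents J m).
  have mI : exponents I m.
    have fI : supported (val f : {mpoly K[n]}) (exponents I).
      by apply: Isupp; apply: ideal_valP.
    by apply: fI; rewrite mcoeff_msupp.
  have [//|i mi] := cov m.
  rewrite (bigD1 i) //= mi big1 ?addr0 ?subrr ?eqxx // => j ji.
  by case: ifP => // mj; move/eqP: ji; case; apply: dis mj mi.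
exists [ffun i => v i *: (tnth (in_tuple D) i).1]; split.
  split=> [i|]; first by rewrite ffunE; exists (v i) => //; rewrite DE; apply: vZ.
  by under eq_bigr do rewrite ffunE; rewrite piE.
move=> ws' [ws'P wE].
have /choice[v' v'P] : forall i, exists v', subpoly (q i).2 v' /\
    ws' i = v' *: (tnth (in_tuple D) i).1.
  by move=> i; have [v'] := ws'P i; rewrite DE; exists v'.
apply/ffunP => i; rewrite ffunE (v'P i).2; congr (_ *: _).
apply/eqP; rewrite -subr_eq0; apply/eqP; move: i; apply: sumJ => [i x j|].
  by move/msuppB_le; rewrite mem_cat => /orP[/vZ|/(v'P i).1]; apply.
have /ideal_pi_eq : ideal_pi J (\sum_i v i *: g (q i).1) =
    ideal_pi J (\sum_i v' i *: g (q i).1).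
  by rewrite -fE wE -piE; apply: eq_bigr => i _; rewrite (v'P i).2.
rewrite !valE -sumrB; congr (_ \in J).
by apply: eq_bigr => i _; rewrite mulrBl.
Qed.

End StanleyCones.

(** * Comparison of Stanley depths *)

Lemma le_enat_refl a : le_enat a a.
Proof. by case: a => /=. Qed.

Lemma le_enat_trans b a c : le_enat a b -> le_enat b c -> le_enat a c.
Proof. by case: a b c => [a|] [b|] [c|] //=; apply: leq_trans. Qed.

Lemma le_min_enatl a b : le_enat (min_enat a b) a.
Proof.
rewrite /min_enat; case: ifP => [_|]; first exact: le_enat_refl.
by case: a b => [a|] [b|] //= /negbT; rewrite -ltnNge => /ltnW.
Qed.

Lemma le_min_enatr a b : le_enat (min_enat a b) b.
Proof. by rewrite /min_enat; case: ifP => // _; apply: le_enat_refl. Qed.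

Lemma le_min_enat c a b : le_enat c a -> le_enat c b -> le_enat c (min_enat a b).
Proof. by rewrite /min_enat; case: ifP. Qed.

(** Discarding cones can only raise the minimum, the empty minimum being infinity. *)
Lemma le_bigmin_enat (T : Type) (s : seq T) (C : pred T) (F : T -> enat) :
  le_enat (\big[min_enat/None]_(x <- s) F x) (\big[min_enat/None]_(x <- s | C x) F x).
Proof.
elim: s => [|x s IH]; first by rewrite !big_nil.
rewrite !big_cons; case: ifP => _; last exact: le_enat_trans (le_min_enatr _ _) IH.
apply: le_min_enat; first exact: le_min_enatl.
exact: le_enat_trans (le_min_enatr _ _) IH.
Qed.

Lemma decomposition_sdepthE (n : nat) (M : Type) (D : seq (M * {set 'I_n})) :
  \big[min_enat/None]_(p <- D) Some #|p.2| =
  \big[min_enat/None]_(Z <- [seq p.2 | p <- D]) Some #|Z|.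
Proof. by rewrite big_map. Qed.

Lemma sdepth_quo_root (K : fieldType) (n l : nat) (I J I' J' : ideal {mpoly K[n]}) :
  closed_under_support J -> closed_under_support I' -> closed_under_support J' ->
  (0 < l)%N ->
  (forall m, ('X_[m] \in I') = ('X_[m *+ l] \in I)) ->
  (forall m, ('X_[m] \in J') = ('X_[m *+ l] \in J)) ->
  le_enat (sdepth_quo I J) (sdepth_quo I' J').
Proof.
move=> sJ sI' sJ' l0 eI eJ; rewrite /sdepth_quo.
have [exD|noD] := pselect (exists D, stanley_decomposition (@ideal_quo_comp _ _ I J) D).
  have [[D hD <-] _] := sdepthP exD.
  have LP := cone_partition_of_decomposition sJ hD.
  have [|D' hD' eD'] := decomposition_of_cone_partition sI' sJ'
    (cone_partition_root (P' := quo_exponents I' J') l0 _ LP).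
    by move=> m; rewrite /quo_exponents /exponents /setD /= eI eJ.
  have [_ max] := sdepthP (ex_intro _ D' hD').
  apply: (le_enat_trans _ (max (decomposition_sdepth D') _)); last by exists D'.
  rewrite /decomposition_sdepth (decomposition_sdepthE D') eD'.
  rewrite !big_map big_filter big_map. exact: le_bigmin_enat.
(* With no Stanley decomposition of [I / J], its [sdepth] is the default [Some 0], the least value
   of [enat]. *)
rewrite /sdepth xgetPN; first by case: xget.
by move=> d [[D hD _] _]; apply: noD; exists D.
Qed.

Theorem theorem2p8 (K : fieldType) (n : nat) (I1 I2 : ideal {mpoly K[n]})
    (hI1 : monomial_ideal I1) (hI2 : monomial_ideal I2)
    (hI21 : {subset I2 <= I1}) :
  exists k : nat, (1 <= k)%N /\
    forall s : nat, (1 <= s)%N ->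
      le_enat
        (sdepth_quo (ideal_exp I1 (s * k)) (ideal_exp I2 (s * k)))
        (sdepth_quo (integral_closure I1) (integral_closure I2)).
Proof.
have s1 := monomial_ideal_support hI1; have s2 := monomial_ideal_support hI2.
have [k1 k1_gt0 h1] := integral_closure_exponent s1.
have [k2 k2_gt0 h2] := integral_closure_exponent s2.
have k_gt0 : (0 < k1 * k2)%N by rewrite muln_gt0 k1_gt0.
(* The product makes the exponent a multiple of both [k1] and [k2], so one power serves both
   ideals. *)
exists (k1 * k2)%N; split=> // s s_gt0.
have l_gt0 : (0 < s * (k1 * k2))%N by rewrite muln_gt0 s_gt0.
apply: (sdepth_quo_root _ _ _ l_gt0).
- exact: ideal_exp_support.
- exact: integral_closure_support.
- exact: integral_closure_support.
- by move=> m; apply: h1; rewrite // dvdn_mull // dvdn_mulr.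
- by move=> m; apply: h2; rewrite // dvdn_mull // dvdn_mull.
Qed.
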